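(* There exist uncountably many pairwise non-isomorphic finitely generated torsion groups which have the $R_\infty$ property.
   Context: A group is torsion if every element has finite order. For a group $G$ and $\phi\in\mathrm{Aut}(G)$ (maps written on the right), elements $a,b\in G$ are $\phi$-twisted conjugate if there is $x\in G$ with $(x^{-1})\phi\, a x=b$; the Reidemeister number $R(\phi)$ is the number of $\phi$-twisted conjugacy classes in $G$. $G$ has the $R_\infty$ property if $R(\phi)=\infty$ (infinitely many classes) for every $\phi\in\mathrm{Aut}(G)$. *)

(* Defs.v *)
From HB Require Import structures.
From mathcomp Require Import all_boot.
From mathcomp Require Import boolp classical_sets functions cardinality.

Set Implicit Arguments.
Unset Strict Implicit.
Unset Printing Implicit Defensive.

Import Algebra.

Local Open Scope classical_set_scope.
Local Open Scope group_scope.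

Definition subgroup_generated (G : groupType) (S : set G) : set G :=
  smallest [set H : set G | group_closed (mem H)] S.

Definition finitely_generated (G : groupType) : Prop :=
  exists S : set G, finite_set S /\ subgroup_generated S = setT.

Definition torsion (G : groupType) : Prop :=
  forall g : G, exists n : nat, (0 < n)%N /\ g ^+ n = 1.

Definition isomorphic (G H : groupType) : Prop :=
  exists f : {multiplicative G -> H}, bijective f.

(* With maps written on the right this reads (x^-1)phi a x = b. *)
Definition twisted_conjugate (G : groupType) (phi : G -> G) (a b : G) : Prop :=
  exists x : G, phi x^-1 * a * x = b.

Definition twisted_class (G : groupType) (phi : G -> G) (a : G) : set G :=
  [set b | twisted_conjugate phi a b].

Definition twisted_classes (G : groupType) (phi : G -> G) : set (set G) :=
  range (twisted_class phi).

(* The Reidemeister number of phi is the cardinality of [twisted_classes phi]. *)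
Definition R_infinity (G : groupType) : Prop :=
  forall phi : {multiplicative G -> G},
    bijective phi -> infinite_set (twisted_classes phi).

(* Main.v *)
From HB Require Import structures.
Require Import Defs.
From mathcomp Require Import all_boot zify.
From mathcomp Require Import all_fingroup all_solvable.
From mathcomp Require Import boolp classical_sets functions cardinality.

Set Implicit Arguments.
Unset Strict Implicit.
Unset Printing Implicit Defensive.

(** Let G be the Gupta-Sidki group, an infinite finitely generated torsion group
    acting on the ternary tree.  For a set X of levels of the tree, consider the
    permutational wreath product of T = Alt(5) by G over the vertices of the
    tree; its elements are pairs of a labelling of the vertices by elements of T
    and a tree automorphism.  Inside it let Gamma_X be generated by G and by a
    copy of T, where t in T is the labelling with value t at the leftmost vertex
    of every level of X and 1 elsewhere.  Gamma_X is finitely generated by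
    construction.  It is torsion because G is ([eval_finite_order]) and labellings
    have exponent at most |T|.

    Since T is perfect, commutators of labellings with their translates under G
    separate the levels, so Gamma_X contains every finitely supported labelling
    on the levels of X ([Gamma_pure]).  When X is infinite these are exactly the
    elements with a finite conjugacy class ([finite_class_act],
    [finite_class_support] and [embed_finite_class]).  The elements x with x^3 = 1
    and a finite class which is already a single orbit under conjugation by
    elements with finite classes are then the labellings by elements of order 3
    (and 1) whose support is a union of full levels; as T has one class of
    elements of order 3, of size k say, the class of x has exactly k^m elements
    if the support has m vertices.  Level n has 3^n vertices and no other union of
    levels has that many, so every isomorphism Gamma_X -> Gamma_Y maps the
    class carried by level n of X onto the class carried by level n of Y, and n
    lies in Y ([iso_level]).  Hence X is an isomorphism invariant, and letting X
    range over a family of sets indexed by binary sequences gives uncountably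
    many isomorphism types.

    The same statement applied to an automorphism phi shows that phi stabilises
    the class K_n carried by each level n of X.  Whether the equation
    phi(c) = a c a^-1 has a solution c in K_n depends only on the phi-twisted
    class of a ([hits_twisted]).  In the finite group N_n of labellings of level
    n both answers occur: the average number of solutions, over a in N_n, is one,
    while solutions come in pairs c, c^-1 ([twisted_avoid]).  Choose d_n in N_n
    for which the answer differs from the one for a = 1.  For m <> n the element
    d_m commutes with K_n, so on K_n it gives the same answer as 1.  The d_n
    therefore lie in infinitely many distinct twisted classes
    ([twisted_classes_infinite]). *)

(** * The Gupta-Sidki group on the ternary tree *)

Definition digit := option bool.
Definition vertex := seq digit.

Definition turn (x : digit) : digit :=
  match x with
  | None => Some false
  | Some false => Some true
  | Some true => None
  end.

Lemma turn3 x : turn (turn (turn x)) = x.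
Proof. by case: x => [[]|]. Qed.

Definition rooted (v : vertex) : vertex :=
  if v is x :: s then turn x :: s else [::].

(** The directed generator t = (a, a^-1, t) with a = [rooted]; the inverse of a is
    written as its square. *)
Fixpoint directed (v : vertex) : vertex :=
  match v with
  | [::] => [::]
  | None :: s => None :: rooted s
  | Some false :: s => Some false :: rooted (rooted s)
  | Some true :: s => Some true :: directed s
  end.

Lemma rooted3 v : rooted (rooted (rooted v)) = v.
Proof. by case: v => //= x s; rewrite turn3. Qed.

Lemma directed3 v : directed (directed (directed v)) = v.
Proof. by elim: v => [|[[]|] s IH] //=; rewrite ?IH ?rooted3. Qed.

Definition letter (b : bool) : vertex -> vertex := if b then directed else rooted.

(** Both generators have order 3, so words without inverses reach the whole
    group. *)
Fixpoint eval (w : seq bool) (v : vertex) : vertex :=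
  if w is b :: w' then letter b (eval w' v) else v.

Lemma eval_cat w1 w2 v : eval (w1 ++ w2) v = eval w1 (eval w2 v).
Proof. by elim: w1 => //= b w1 ->. Qed.

Definition rot_len (w : seq bool) := count negb w.
Definition dir_len (w : seq bool) := count id w.

(** The automorphism induced by the directed generator on the subtree at [x]. *)
Definition letter_section (x : digit) : seq bool :=
  match x with
  | None => [:: false]
  | Some false => [:: false; false]
  | Some true => [:: true]
  end.

Fixpoint section (w : seq bool) (x : digit) : seq bool :=
  if w is b :: w' then
    (if b then letter_section (iter (rot_len w') turn x) else [::]) ++ section w' x
  else [::].

Lemma eval_cons w x s :
  eval w (x :: s) = iter (rot_len w) turn x :: eval (section w x) s.
Proof.
elim: w => //= b w ->; case: b => //=.
by case: (iter _ _ _) => [[]|].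
Qed.

Lemma section_cat w1 w2 x :
  section (w1 ++ w2) x = section w1 (iter (rot_len w2) turn x) ++ section w2 x.
Proof.
elim: w1 => //= b w1 ->; case: b => //=.
by rewrite /rot_len count_cat iterD catA.
Qed.

Lemma dir_len_cat w1 w2 : dir_len (w1 ++ w2) = dir_len w1 + dir_len w2.
Proof. exact: count_cat. Qed.

Lemma rot_len_cat w1 w2 : rot_len (w1 ++ w2) = rot_len w1 + rot_len w2.
Proof. exact: count_cat. Qed.

Lemma iter_turn_mod n x : iter n turn x = iter (n %% 3) turn x.
Proof.
rewrite [in LHS](divn_eq n 3) addnC iterD; congr iter.
by elim: (n %/ 3) => // k IH; rewrite mulSn iterD IH /= turn3.
Qed.

(** As [x] runs over the three digits, so does the digit seen by a given directed
    letter of [w]; that letter thus contributes one directed letter to exactly one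
    of the three sections. *)
Lemma dir_len_sections w :
  dir_len (section w None) + dir_len (section w (Some false))
    + dir_len (section w (Some true)) = dir_len w.
Proof.
elim: w => //= -[] w IH //=; rewrite !dir_len_cat.
rewrite -[in RHS]/(dir_len w) -IH /dir_len !(iter_turn_mod (rot_len w)).
by have := ltn_pmod (rot_len w) (isT : 0 < 3);
  case: (_ %% 3) => [|[|[]]] //= _; rewrite ?add0n ?add1n ?addnS ?addSn.
Qed.

(** Each directed letter contributes a, a^2 and t to the three sections, hence
    1 + 2 rotations.  Only the value modulo 3 of this total matters: it is the
    cancellation between a and a^-1 that makes the group torsion. *)
Lemma rot_len_sections w :
  rot_len (section w None) + rot_len (section w (Some false))
    + rot_len (section w (Some true)) = 3 * dir_len w.
Proof.
elim: w => //= -[] w IH //=; rewrite !rot_len_cat mulnDr.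
rewrite -[X in _ = _ + 3 * X]/(dir_len w) -IH /rot_len !(iter_turn_mod (count negb w)).
by have := ltn_pmod (count negb w) (isT : 0 < 3);
  case: (_ %% 3) => [|[|[]]] //= _; rewrite ?add0n ?addnS ?addSn.
Qed.

Lemma dir_len_section_le w x : dir_len (section w x) <= dir_len w.
Proof. by have := dir_len_sections w; case: x => [[]|]; lia. Qed.

(** A section that loses no directed letter consists of directed letters only,
    because any other directed letter would have left a rotation behind. *)
Lemma section_directed w x :
  dir_len (section w x) = dir_len w -> section w x = nseq (dir_len w) true.
Proof.
elim: w => //= -[] w IH; rewrite ?dir_len_cat //=.
have := dir_len_section_le w x; rewrite /dir_len -/dir_len.
case: (iter _ _ _) => [[]|] /=; rewrite -?/(dir_len _) ?addn0 ?add0n ?add1n; try lia.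
by move=> _ [] /IH ->.
Qed.

Definition finite_order (T : Type) (f : T -> T) :=
  exists n, 0 < n /\ forall v, iter n f v = v.

Lemma iter_mul_fix (T : Type) (f : T -> T) n m v :
  (forall v, iter n f v = v) -> iter (m * n) f v = v.
Proof. by move=> fn; elim: m => // m IH; rewrite mulSn iterD IH fn. Qed.

Lemma finite_order_root T (f : T -> T) m :
  0 < m -> finite_order (iter m f) -> finite_order f.
Proof.
move=> m0 [n [n0 fn]]; exists (n * m); split; first by rewrite muln_gt0 n0.
by move=> v; rewrite iterM fn.
Qed.

Lemma finite_order_directed n : finite_order (eval (nseq n true)).
Proof.
exists 3; split=> // v.
have E u : eval (nseq n true) u = iter n directed u by elim: n => //= n ->.
rewrite (eq_iter E) -iterM mulnC.
by elim: n {E} => // n IH; rewrite mulSn iterD IH /= directed3.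
Qed.

Lemma finite_order_sections w :
  rot_len w %% 3 = 0 -> (forall x, finite_order (eval (section w x))) ->
  finite_order (eval w).
Proof.
move=> w0 fin_sec.
have [n0 [n0_gt0 fix0]] := fin_sec None.
have [n1 [n1_gt0 fix1]] := fin_sec (Some false).
have [n2 [n2_gt0 fix2]] := fin_sec (Some true).
exists (n0 * n1 * n2); split; first by rewrite !muln_gt0 n0_gt0 n1_gt0.
case=> [|x s].
  have fix_nil : eval w [::] = [::].
    by elim: w {w0 fin_sec fix0 fix1 fix2} => //= -[] w ->.
  by elim: (n0 * n1 * n2) => //= n ->.
have E n : iter n (eval w) (x :: s) = x :: iter n (eval (section w x)) s.
  by elim: n => //= n ->; rewrite eval_cons iter_turn_mod w0.
rewrite E; congr (_ :: _); case: x {E} => [[]|].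
- exact: iter_mul_fix.
- by rewrite mulnAC; apply: iter_mul_fix.
- by rewrite -mulnA mulnC; apply: iter_mul_fix.
Qed.

(** Induction on the number of directed letters.  If [w] fixes the first level it
    acts on the three subtrees through its sections, each of which is shorter or a
    power of the directed generator.  Otherwise the cube of [w] fixes the first
    level, and each of its sections is a product of the three sections of [w] in
    some order; by the two counts above it is as long as [w] and fixes the first
    level, so that the first case applies to it. *)
Theorem eval_finite_order w : finite_order (eval w).
Proof.
have [n] := ubnP (dir_len w); elim: n w => // n IH w; rewrite ltnS => w_n.
have level_fixing u : dir_len u = dir_len w -> rot_len u %% 3 = 0 -> finite_order (eval u).
  move=> u_w u0; apply: finite_order_sections => // x.
  have [ux|ux] := eqVneq (dir_len (section u x)) (dir_len u).
    by rewrite section_directed //; apply: finite_order_directed.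
  apply: IH; apply: leq_trans w_n; rewrite -u_w ltn_neqAle ux.
  exact: dir_len_section_le.
have [/level_fixing|w_rot] := eqVneq (rot_len w %% 3) 0; first exact.
apply: (@finite_order_root _ _ 3) => //.
suff [n1 [n1_gt0 fix1]] : finite_order (eval (w ++ w ++ w)).
  exists n1; split=> // v; rewrite -[RHS]fix1; apply: eq_iter => u /=.
  by rewrite !eval_cat.
apply: finite_order_sections => [|x].
  by rewrite !rot_len_cat; lia.
have sum_dir := dir_len_sections w; have sum_rot := rot_len_sections w.
rewrite !section_cat rot_len_cat iterD.
have lt3 := ltn_pmod (rot_len w) (isT : 0 < 3).
apply: level_fixing.
  rewrite !dir_len_cat !(iter_turn_mod (rot_len w)).
  move: lt3 w_rot; case: (_ %% 3) => [|[|[]]] //= _ _;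
    by case: x => [[]|] /=; lia.
rewrite !rot_len_cat !(iter_turn_mod (rot_len w)).
move: lt3 w_rot; case: (_ %% 3) => [|[|[]]] //= _ _;
  by case: x => [[]|] /=; lia.
Qed.

(** * Transitivity on the levels of the tree *)
Lemma size_rooted v : size (rooted v) = size v. Proof. by case: v. Qed.

Lemma size_directed v : size (directed v) = size v.
Proof. by elim: v => //= -[[]|] s IH /=; rewrite ?size_rooted ?IH. Qed.

Lemma size_eval w v : size (eval w v) = size v.
Proof. by elim: w => //= -[] w <-; rewrite /letter ?size_rooted ?size_directed. Qed.

Lemma take_eval w k v : eval w (take k v) = take k (eval w v).
Proof.
have take_rooted i u : rooted (take i u) = take i (rooted u).
  by case: u i => [|x s] [].
have take_directed i u : directed (take i u) = take i (directed u).
  by elim: u i => [|[[]|] s IH] [|i] //=; rewrite ?take_rooted ?IH.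
by elim: w => //= -[] w -> /=.
Qed.

Lemma eval_inverse w : exists w', cancel (eval w) (eval w') /\ cancel (eval w') (eval w).
Proof.
elim: w => [|b w [w' [wK w'K]]]; first by exists [::].
have letter3 v : letter b (letter b (letter b v)) = v.
  by case: b; rewrite /= ?rooted3 ?directed3.
exists (w' ++ [:: b; b]); split=> v; rewrite eval_cat /=.
  by rewrite letter3.
by rewrite w'K.
Qed.

(** The first section of t is a, and that of the conjugate a t a^-1 is t; so
    each word is the first section of a word fixing the first digit. *)
Definition lift_word (w : seq bool) : seq bool :=
  flatten [seq if b then [:: false; true; false; false] else [:: true] | b <- w].

Lemma eval_lift_word w s : eval (lift_word w) (None :: s) = None :: eval w s.
Proof. by elim: w => //= -[] w IH; rewrite eval_cat IH. Qed.

Lemma eval_transitive v u : size v = size u -> exists w, eval w v = u.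
Proof.
suff to0 t : exists w, eval w t = nseq (size t) None.
  move=> vu; have [w1 E1] := to0 v; have [w2 E2] := to0 u.
  have [w3 [w2K _]] := eval_inverse w2.
  by exists (w3 ++ w1); rewrite eval_cat E1 vu -E2 w2K.
elim: t => [|x s [w IH]]; first by exists [::].
have [k Ek] : exists k, eval (nseq k false) (x :: s) = None :: s.
  by case: x => [[]|]; [exists 1|exists 2|exists 0].
by exists (lift_word w ++ nseq k false); rewrite eval_cat Ek eval_lift_word IH.
Qed.

Definition spine n : vertex := nseq n None.

(** Move the spine vertex of level n+1 to a different child of the spine vertex
    of level n: prefixes are preserved, so the spine is fixed up to level n and
    moved below. *)
Lemma eval_stabilizer n : exists w, forall j, (eval w (spine j) == spine j) = (j <= n).
Proof.
have [w Ew] : exists w, eval w (spine n.+1) = rcons (spine n) (Some false).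
  by apply: eval_transitive; rewrite size_rcons !size_nseq.
have take_spine i j : i <= j -> take i (spine j) = spine i.
  by move=> ij; rewrite /spine take_nseq.
exists w => j; apply/idP/idP; last first.
  move=> jn; rewrite -(take_spine j n.+1) ?(leq_trans jn) // take_eval Ew.
  by rewrite -cats1 takel_cat ?size_nseq // !take_spine // ltnW.
apply: contraTT; rewrite -ltnNge => nj; apply/eqP => Ej.
have := congr1 (take n.+1) Ej; rewrite -take_eval take_spine // Ew.
by move/(congr1 (last None)); rewrite last_rcons /spine -addn1 nseqD last_cat.
Qed.

(** * The groups Gamma_X *)
Local Open Scope card_scope.
Local Open Scope classical_set_scope.
Local Open Scope group_scope.

Definition order3 (T : finGroupType) : pred T := [pred t | (t != 1) && (t ^+ 3 == 1)].

Definition perfect (T : finGroupType) :=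
  forall H : {group T}, (forall x y, [~ x, y] \in H) -> forall x, x \in H.

Definition centerless (T : finGroupType) :=
  forall b : T, b != 1 -> exists t, [~ b, t] != 1.

Definition order3_transitive (T : finGroupType) :=
  forall t u : T, order3 t -> order3 u -> exists z, t ^ z = u.

Definition unbounded (X : nat -> bool) := forall n, exists2 m, (n <= m)%N & X m.

Section Wreath.
Variable T : finGroupType.

(** An element [x] stands for the permutation (v, s) |-> (act x v, base x v * s)
    of vertices paired with elements of [T].  The inverse permutation is part of
    the data so that inversion needs no choice. *)
Record wreath := Wreath {
  base : vertex -> T;
  act : vertex -> vertex;
  iact : vertex -> vertex;
  _ : cancel act iact;
  _ : cancel iact act }.

Lemma actK x : cancel (act x) (iact x). Proof. by case: x. Qed.
Lemma iactK x : cancel (iact x) (act x). Proof. by case: x. Qed.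

Lemma wreathP x y : base x =1 base y -> act x =1 act y -> x = y.
Proof.
move=> /funext eb /funext ea.
have ei : iact x = iact y.
  by apply: funext => v; rewrite -[RHS](actK x) ea iactK.
case: x y eb ea ei => [b a i c1 c2] [b' a' i' c1' c2'] /= eb ea ei.
subst b' a' i'; congr Wreath; exact: Prop_irrelevance.
Qed.

HB.instance Definition _ := gen_eqMixin wreath.
HB.instance Definition _ := gen_choiceMixin wreath.

Definition wreath_one := @Wreath (fun=> 1) id id (fun=> erefl) (fun=> erefl).

Definition wreath_mul (x y : wreath) : wreath :=
  @Wreath (fun v => base x (act y v) * base y v) (act x \o act y)
    (iact y \o iact x)
    (can_comp (@actK x) (@actK y)) (can_comp (@iactK y) (@iactK x)).

Definition wreath_inv (x : wreath) : wreath :=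
  @Wreath (fun v => (base x (iact x v))^-1) (iact x) (act x) (@iactK x) (@actK x).

Fact wreath_mulA : associative wreath_mul.
Proof. by move=> x y z; apply: wreathP => v //=; rewrite mulgA. Qed.
Fact wreath_mul1 : left_id wreath_one wreath_mul.
Proof. by move=> x; apply: wreathP => v //=; rewrite mul1g. Qed.
Fact wreath_mulr1 : right_id wreath_one wreath_mul.
Proof. by move=> x; apply: wreathP => v //=; rewrite mulg1. Qed.
Fact wreath_mulV : left_inverse wreath_one wreath_inv wreath_mul.
Proof. by move=> x; apply: wreathP => v /=; rewrite actK // mulVg. Qed.
Fact wreath_mulrV : right_inverse wreath_one wreath_inv wreath_mul.
Proof. by move=> x; apply: wreathP => v /=; rewrite ?iactK // mulgV. Qed.

HB.instance Definition _ := isGroup.Build wreath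
  wreath_mulA wreath_mul1 wreath_mulr1 wreath_mulV wreath_mulrV.

Lemma baseM x y v : base (x * y) v = base x (act y v) * base y v.
Proof. by []. Qed.
Lemma actM x y v : act (x * y) v = act x (act y v). Proof. by []. Qed.
Lemma baseV x v : base x^-1 v = (base x (iact x v))^-1. Proof. by []. Qed.
Lemma actV x v : act x^-1 v = iact x v. Proof. by []. Qed.

Lemma actX x n v : act (x ^+ n) v = iter n (act x) v.
Proof. by elim: n => // n IH; rewrite expgS actM IH. Qed.

Definition rooted_elt : wreath :=
  @Wreath (fun=> 1) rooted (rooted \o rooted) rooted3 rooted3.
Definition directed_elt : wreath :=
  @Wreath (fun=> 1) directed (directed \o directed) directed3 directed3.
Definition pure (b : vertex -> T) : wreath :=
  @Wreath b id id (fun=> erefl) (fun=> erefl).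

Lemma pureM b c : pure b * pure c = pure (fun v => b v * c v).
Proof. exact: wreathP. Qed.
Lemma pureV b : (pure b)^-1 = pure (fun v => (b v)^-1).
Proof. exact: wreathP. Qed.

Variable X : nat -> bool.

Definition spine_fun (x : T) (v : vertex) : T :=
  if (v == spine (size v)) && X (size v) then x else 1.

Definition gens : set wreath :=
  [set rooted_elt; directed_elt] `|` [set pure (spine_fun x) | x in setT].

Definition Gamma_set : set wreath := subgroup_generated gens.

Lemma Gamma_ind (P : wreath -> Prop) :
  P 1 -> (forall x y, P x -> P y -> P (x * y)) -> (forall x, P x -> P x^-1) ->
  P rooted_elt -> P directed_elt -> (forall x, P (pure (spine_fun x))) ->
  forall x, Gamma_set x -> P x.
Proof.
move=> P1 PM PV Pr Pd Ps; apply: smallest_sub; last first.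
  by move=> x [[->|->]|[y _ <-]].
split; first by rewrite inE.
by move=> x y; rewrite !inE => Px Py; apply: PM => //; apply: PV.
Qed.

Lemma Gamma_closed : group_closed (mem Gamma_set).
Proof.
split; first by rewrite inE => H [[H1 _] _]; move: H1; rewrite inE.
move=> x y; rewrite !inE => xG yG H [HG gH]; have /(_ x y) := HG.2.
by rewrite !inE; apply; [apply: xG|apply: yG].
Qed.

Lemma Gamma_1 : Gamma_set 1.
Proof. by have := Gamma_closed.1; rewrite inE. Qed.
Lemma Gamma_V x : Gamma_set x -> Gamma_set x^-1.
Proof. by have := group_closedV Gamma_closed (x:=x); rewrite !inE. Qed.
Lemma Gamma_M x y : Gamma_set x -> Gamma_set y -> Gamma_set (x * y).
Proof. by have := group_closedM Gamma_closed (x:=x) (y:=y); rewrite !inE. Qed.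
Lemma Gamma_gens x : gens x -> Gamma_set x.
Proof. exact: sub_gen_smallest. Qed.

Lemma Gamma_eval x : Gamma_set x -> exists w, act x =1 eval w.
Proof.
move: x; apply: Gamma_ind => [|x y [u Eu] [v Ev]|x [w Ew]|||y].
- by exists [::].
- by exists (u ++ v) => s; rewrite eval_cat -Ev -Eu.
- have [w' [wK w'K]] := eval_inverse w.
  by exists w' => v; rewrite actV -[in LHS](w'K v) -Ew actK.
- by exists [:: false].
- by exists [:: true].
- by exists [::].
Qed.

Lemma eval_Gamma w : exists x, [/\ Gamma_set x, act x =1 eval w & base x =1 fun=> 1].
Proof.
elim: w => [|b w [x [xG ax bx]]]; first by exists 1; split=> //; apply: Gamma_1.
exists ((if b then directed_elt else rooted_elt) * x); split.
- by apply: Gamma_M => //; apply: Gamma_gens; left; case: b; [right|left].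
- by move=> v; rewrite actM ax; case: b.
- by move=> v; rewrite baseM bx; case: b; rewrite /= mulg1.
Qed.

Lemma Gamma_base x : Gamma_set x -> forall v, ~~ X (size v) -> base x v = 1.
Proof.
move=> xG; suff [] : (forall v, ~~ X (size v) -> base x v = 1) /\
   (forall v, size (iact x v) = size v) /\ (forall v, size (act x v) = size v) by [].
move: x xG; apply: Gamma_ind => //=.
- move=> x y [bx [ix ax]] [by_ [iy ay]]; split=> [v Xv|]; last first.
    by split=> v; rewrite ?iy ?ix ?ax ?ay.
  by rewrite bx ?ay // by_ // mulg1.
- by move=> x [bx [ix ax]]; split=> // v Xv; rewrite bx ?ix // invg1.
- by split=> //; split=> v; rewrite ?size_rooted.
- by split=> //; split=> v; rewrite ?size_directed.
- by move=> y; split=> // v /negPf Xv; rewrite /spine_fun Xv andbF.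
Qed.

Lemma Gamma_torsion x : Gamma_set x -> exists n, (0 < n)%N /\ x ^+ n = 1.
Proof.
move=> /Gamma_eval[w Ew]; have [n [n0 En]] := eval_finite_order w.
exists (n * #|T|)%N; split.
  by rewrite muln_gt0 n0; apply/card_gt0P; exists 1.
rewrite expgM; have an v : act (x ^+ n) v = v by rewrite actX (eq_iter Ew).
apply: wreathP => v; last by rewrite actX; elim: #|T| => //= m ->.
have -> : base (x ^+ n ^+ #|T|) v = base (x ^+ n) v ^+ #|T|.
  elim: #|T| => // m IH; rewrite expgS baseM IH [RHS]expgS; congr (base _ _ * _).
  by rewrite actX; elim: m {IH} => //= m ->.
by apply/eqP; rewrite -cardsT -order_dvdn (order_dvdG (G := [set: T]%G)) ?inE.
Qed.

End Wreath.

(** * Finitely supported labellings *)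
Section FiniteSupport.
Variables (T : finGroupType) (X : nat -> bool).
Hypothesis perfectT : perfect T.

Lemma pureR (b c : vertex -> T) : [~ pure b, pure c] = pure (fun v => [~ b v, c v]).
Proof. exact: wreathP. Qed.

Lemma pureJ (g : wreath T) b : base g =1 (fun=> 1) ->
  g * pure b * g^-1 = pure (b \o iact g).
Proof.
move=> bg; apply: wreathP => v /=; last by rewrite iactK.
by rewrite !bg invg1 mulg1 mul1g.
Qed.

Definition spine_below n (x : T) (v : vertex) : T :=
  if [&& v == spine (size v), X (size v) & size v < n] then x else 1.

(** Take g in G fixing the spine down to level n and moving it below.  Then
    the commutator of the generator for y with the g-conjugate of the generator
    for z is the labelling by [~ y, z] on the fixed part of the spine and is
    trivial below.  As T is perfect, all labels x are obtained. *)
Lemma Gamma_spine_below n x : Gamma_set X (pure (spine_below n x)).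
Proof.
case: n => [|n] in x *.
  suff -> : pure (spine_below 0 x) = 1 by apply: Gamma_1.
  by apply: wreathP => v //; rewrite /= /spine_below !andbF.
pose S : {set T} := [set y | `[< Gamma_set X (pure (spine_below n.+1 y)) >]]%SET.
have group_S : group_set S.
  apply/group_setP; split=> [|y z].
    rewrite finset.in_set; apply/asboolP.
    suff -> : pure (spine_below n.+1 1) = 1 :> wreath T by apply: Gamma_1.
    by apply: wreathP => v //; rewrite /= /spine_below if_same.
  rewrite !finset.in_set => /asboolP yG /asboolP zG; apply/asboolP.
  have := Gamma_M yG zG; rewrite pureM; congr Gamma_set; apply: wreathP => v //=.
  by rewrite /spine_below; case: ifP; rewrite ?mulg1.
suff /perfectT/(_ x) : forall y z, [~ y, z] \in Group group_S.
  by rewrite finset.in_set => /asboolP.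
move=> y z; rewrite finset.in_set; apply/asboolP.
have [w Ew] := eval_stabilizer n; have [g [gG ag bg]] := eval_Gamma T X w.
have yG : Gamma_set X (pure (spine_fun X y)) by apply: Gamma_gens; right; exists y.
have zG : Gamma_set X (pure (spine_fun X z)) by apply: Gamma_gens; right; exists z.
have {}zG := Gamma_M (Gamma_M gG zG) (Gamma_V gG); rewrite pureJ // in zG.
have := Gamma_M (Gamma_V yG) (Gamma_M (Gamma_V zG) (Gamma_M yG zG)).
rewrite -[X in Gamma_set _ X]/([~ _, _]) pureR; congr Gamma_set; apply: wreathP => v //=.
rewrite /spine_below /spine_fun ltnS.
have [v_spine|] := eqVneq v (spine (size v)); last by rewrite comm1g.
have [] /= := boolP (X (size v)) => Xv; last by rewrite comm1g.
have Esize : size (iact g v) = size v by rewrite -{2}(iactK g v) ag size_eval.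
rewrite Esize Xv andbT -Ew -ag -v_spine.
case: eqVneq => [Ei|Ni]; case: eqVneq => [Ea|Na] //; rewrite ?commg1 //.
  by case/eqP: Na; rewrite -{1}Ei iactK.
by case/eqP: Ni; rewrite -{1}Ea actK.
Qed.

Definition delta (v : vertex) (x : T) (u : vertex) : T := if u == v then x else 1.

(** On the spine, divide the truncations to two consecutive levels; then move the
    result to any vertex of that level by transitivity. *)
Lemma Gamma_delta v x : X (size v) -> Gamma_set X (pure (delta v x)).
Proof.
move=> Xv; have [w Ew] : exists w, eval w (spine (size v)) = v.
  by apply: eval_transitive; rewrite size_nseq.
have [g [gG ag bg]] := eval_Gamma T X w.
have spineG : Gamma_set X (pure (delta (spine (size v)) x)).
  have := Gamma_M (Gamma_spine_below (size v).+1 x) (Gamma_V (Gamma_spine_below (size v) x)).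
  rewrite pureV pureM; congr Gamma_set; apply: wreathP => u //=.
  rewrite /spine_below /delta.
  have [Eu|Nu] := eqVneq u (spine (size u)); last first.
    by rewrite invg1 mulg1; case: eqP => // Eu; case/eqP: Nu; rewrite Eu size_nseq.
  have [E|N] := eqVneq (size u) (size v).
    by rewrite -E -Eu eqxx E Xv ltnSn ltnn /= invg1 mulg1.
  have -> : (u == spine (size v)) = false.
    by apply: contraNF N => /eqP ->; rewrite size_nseq.
  by rewrite ltnS leq_eqVlt (negPf N) /=; case: ifP; rewrite ?mulgV // invg1 mulg1.
have := Gamma_M (Gamma_M gG spineG) (Gamma_V gG); rewrite pureJ //; congr Gamma_set.
apply: wreathP => u //=; rewrite /delta.
by rewrite (can2_eq (iactK g) (actK g)) ag Ew.
Qed.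

Lemma Gamma_pure (s : seq vertex) (b : vertex -> T) :
  (forall v, b v != 1 -> (v \in s) && X (size v)) -> Gamma_set X (pure b).
Proof.
elim: s b => [|v s IH] b b_s.
  suff -> : pure b = 1 by apply: Gamma_1.
  by apply: wreathP => u //=; have [//|/b_s] := eqVneq (b u) 1.
have -> : pure b = pure (delta v (b v)) * pure (fun u => if u == v then 1 else b u).
  rewrite pureM; apply: wreathP => u //=; rewrite /delta.
  by case: eqP => [->|_]; rewrite ?mulg1 ?mul1g.
apply: Gamma_M.
  have [E|N] := eqVneq (b v) 1; last by apply: Gamma_delta; case/andP: (b_s v N).
  suff -> : pure (delta v (b v)) = 1 by apply: Gamma_1.
  by apply: wreathP => u //=; rewrite /delta E if_same.
apply: IH => u; case: ifP => [_|/negbT uv bu]; first by rewrite eqxx.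
by have := b_s u bu; rewrite in_cons (negPf uv).
Qed.

End FiniteSupport.

(** * Finite conjugacy classes *)
Definition conj_class (G : groupType) (x : G) : set G := range (fun y => x ^ y).

Definition finite_class (G : groupType) (x : G) := finite_set (conj_class x).

(** A notion invariant under isomorphisms which, in Gamma_X, singles out the
    labellings of order dividing 3 supported on unions of full levels: conjugation by
    elements with finite classes does not move the support, whereas conjugation by
    the whole group makes it invariant under G. *)
Definition homogeneous3 (G : groupType) (x : G) :=
  [/\ x ^+ 3 = 1, finite_class x & forall y, exists2 z, finite_class z & x ^ y = x ^ z].

Section Iso.
Variables (G H : groupType) (f : {multiplicative G -> H}).
Hypothesis bij_f : bijective f.

Lemma multiplicative1 : f 1 = 1.
Proof. by apply: (mulgI (f 1)); rewrite -gmulfM !mulg1. Qed.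

Lemma multiplicativeV x : f x^-1 = (f x)^-1.
Proof. by apply: (mulgI (f x)); rewrite -gmulfM !mulgV multiplicative1. Qed.

Lemma multiplicativeJ x y : f (x ^ y) = f x ^ f y.
Proof. by rewrite !conjgE !gmulfM multiplicativeV. Qed.

Lemma multiplicativeX x n : f (x ^+ n) = f x ^+ n.
Proof. by elim: n => [|n IH]; rewrite ?multiplicative1 // !expgS gmulfM IH. Qed.

Lemma conj_class_iso x : conj_class (f x) = f @` conj_class x.
Proof.
have [g fK gK] := bij_f; apply/seteqP; split=> [_ [y _ <-]|_ [_ [y _ <-] <-]].
  by exists (x ^ g y); [exists (g y)|rewrite multiplicativeJ gK].
by rewrite multiplicativeJ; exists (f y).
Qed.

Lemma finite_class_iso x : finite_class x -> finite_class (f x).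
Proof. by rewrite /finite_class conj_class_iso; apply: finite_image. Qed.

Lemma homogeneous3_iso x : homogeneous3 x -> homogeneous3 (f x).
Proof.
have [g fK gK] := bij_f; case=> x3 xfc xinv; split.
- by rewrite -multiplicativeX x3 multiplicative1.
- exact: finite_class_iso.
- move=> y; have [z zfc E] := xinv (g y); exists (f z); first exact: finite_class_iso.
  by rewrite -multiplicativeJ -E multiplicativeJ gK.
Qed.
End Iso.

Section GammaGroup.
Variables (T : finGroupType) (X : nat -> bool).

Record Gamma := MkGamma { elt : wreath T; eltP : elt \in Gamma_set X }.
HB.instance Definition _ := [isSub for elt].
HB.instance Definition _ := [Choice of Gamma by <:].
HB.instance Definition _ :=
  SubChoice_isSubGroup.Build (wreath T) (mem (Gamma_set X)) Gamma (Gamma_closed T X).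

End GammaGroup.

Section GammaTheory.
Variables (T : finGroupType) (X : nat -> bool).
Hypothesis perfectT : perfect T.
Hypothesis centerlessT : centerless T.
Hypothesis unboundedX : unbounded X.
Variable t3 : T.
Hypothesis t3_neq1 : t3 != 1.
Local Notation Gamma := (Gamma T X).

Lemma Gamma_eval_act (x : Gamma) : exists w, act (elt x) =1 eval w.
Proof. by have := eltP x; rewrite inE => /Gamma_eval. Qed.

Lemma base_outside (x : Gamma) v : ~~ X (size v) -> base (elt x) v = 1.
Proof. by have := eltP x; rewrite inE => /Gamma_base; apply. Qed.

Lemma base_commg (x y : wreath T) u : act y =1 id ->
  base [~ x, y] u = (base y (act x u))^-1 ^ base x u * base y u.
Proof.
move=> y1; have iy1 v : iact y v = v by rewrite -[in RHS](iactK y v) y1.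
by rewrite /= !y1 !iy1 !actK conjgE !mulgA.
Qed.

Definition point_elt v (t : T) : Gamma := insubd 1 (pure (delta v t)).

Lemma elt_delta v t : X (size v) -> elt (point_elt v t) = pure (delta v t).
Proof. by move=> Xv; apply: insubdK; apply: mem_set; apply: Gamma_delta. Qed.

(** The vertices [v] such that [x] does not commute with the whole copy of [T]
    at [v]. *)
Definition moved (x : Gamma) : set vertex :=
  [set v | X (size v) /\ (act (elt x) v != v \/ base (elt x) v != 1)].

Definition support (x : Gamma) : set vertex := [set v | base (elt x) v != 1].

Lemma moved_commg (x : Gamma) v : moved x v ->
  exists y : Gamma, support [~ x, y] v /\ finite_set (support [~ x, y]).
Proof.
case=> Xv x_v.
have base_c t u : base (elt [~ x, point_elt v t]) u
    = (delta v t (act (elt x) u))^-1 ^ base (elt x) u * delta v t u.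
  by rewrite -[elt _]/([~ elt x, elt (point_elt v t)]) elt_delta // base_commg.
have fin t : finite_set (support [~ x, point_elt v t]).
  apply: (@sub_finite_set _ _ [set v; iact (elt x) v]); last exact: finite_set2.
  move=> u; rewrite /support /mkset base_c /delta.
  have [->|_] := eqVneq u v; first by left.
  have [<-|_] := eqVneq (act (elt x) u) v; first by right; rewrite actK.
  by rewrite invg1 conj1g mulg1 eqxx.
have [Ex|Nx] := eqVneq (act (elt x) v) v.
  have [t t1] : exists t, [~ base (elt x) v, t] != 1.
    by apply: centerlessT; case: x_v => //; rewrite Ex eqxx.
  exists (point_elt v t); split=> //.
  by rewrite /support /mkset base_c Ex /delta eqxx -commgEr.
exists (point_elt v t3); split=> //.
by rewrite /support /mkset base_c /delta (negPf Nx) eqxx invg1 conj1g mul1g.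
Qed.

(** For [v] in [moved x] there is a conjugate z of x such that x^-1 z has finite
    support containing [v]; finitely many conjugates thus cover only finitely many
    vertices. *)
Lemma finite_moved (x : Gamma) : finite_class x -> finite_set (moved x).
Proof.
move=> x_fc; pose F z := [set v | finite_set (support (x^-1 * z)) /\ support (x^-1 * z) v].
apply: (@sub_finite_set _ _ (\bigcup_(z in conj_class x) F z)).
  move=> v /moved_commg[y [yv y_fin]]; exists (x ^ y); first by exists y.
  by split.
apply: bigcup_finite => // z _.
have [zfin|zinf] := pselect (finite_set (support (x^-1 * z))).
  by apply: sub_finite_set zfin => v [].
by apply: (@sub_finite_set _ _ set0) => // v [].
Qed.

Lemma act_moved (x : Gamma) v s : act (elt x) v != v -> act (elt x) (v ++ s) != v ++ s.
Proof.
have [w Ew] := Gamma_eval_act x; apply: contra => /eqP E; apply/eqP.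
have := congr1 (take (size v)) E; rewrite take_size_cat // !Ew -take_eval.
by rewrite take_size_cat.
Qed.

(** If [x] moves a vertex it moves all its descendants, hence vertices on
    infinitely many levels of [X]. *)
Lemma finite_class_act (x : Gamma) : finite_class x -> act (elt x) =1 id.
Proof.
move=> x_fc v; apply/eqP; apply: contraPT (finite_moved x_fc) => Nv.
move=> /finite_seqP[s Es].
pose N := (\max_(u <- s) size u).+1; have [m Nm Xm] := unboundedX (N + size v).
pose u := v ++ spine (m - size v).
have size_u : size u = m.
  by rewrite size_cat size_nseq subnKC // (leq_trans _ Nm) // leq_addl.
have : moved x u by split; [rewrite size_u|left; apply: act_moved].
rewrite Es /= => us; have : size u < N by rewrite ltnS; apply: leq_bigmax_seq.
by rewrite size_u ltnNge (leq_trans _ Nm) // leq_addr.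
Qed.

Lemma finite_class_support (x : Gamma) : finite_class x -> finite_set (support x).
Proof.
move=> /finite_moved; apply: sub_finite_set => v xv; split; last by right.
by apply: contraNT xv => /base_outside ->.
Qed.

Definition vertices n : seq vertex := [seq tval t | t : n.-tuple digit].

Lemma mem_vertices n v : (v \in vertices n) = (size v == n).
Proof.
apply/mapP/eqP => [[t _ ->]|vn]; first exact: size_tuple.
by exists (Tuple (introT eqP vn)); rewrite ?mem_enum.
Qed.

Lemma uniq_vertices n : uniq (vertices n).
Proof. by rewrite map_inj_uniq ?enum_uniq //; apply: val_inj. Qed.

Lemma size_vertices n : size (vertices n) = (3 ^ n)%N.
Proof. by rewrite size_map -cardE card_tuple card_option card_bool. Qed.

(** Labellings supported on the finite set [s], seen through the finite group of
    functions on [s], so that results on finite groups apply to them. *)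
Definition extend (s : seq vertex) (h : {dffun seq_sub s -> T}) (v : vertex) : T :=
  if insub v is Some i then h i else 1.

Lemma extend_out s h v : v \notin s -> extend (s:=s) h v = 1.
Proof. by move=> vs; rewrite /extend insubN. Qed.

Lemma extend_in s h (i : seq_sub s) : extend h (ssval i) = h i.
Proof. by rewrite /extend valK. Qed.

Definition embed (s : seq vertex) (h : {dffun seq_sub s -> T}) : Gamma :=
  insubd 1 (pure (extend h)).

Definition in_levels (s : seq vertex) := all (fun v => X (size v)) s.

Lemma elt_embed s h : in_levels s -> elt (embed (s:=s) h) = pure (extend h).
Proof.
move=> Xs; apply: insubdK; apply: mem_set; apply: (Gamma_pure perfectT (s := s)) => v.
have [vs|vs] := boolP (v \in s); last by rewrite extend_out ?eqxx.
by move=> _; apply: (allP Xs).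
Qed.

Definition restrict (s : seq vertex) (x : Gamma) : {dffun seq_sub s -> T} :=
  [ffun i : seq_sub s => base (elt x) (ssval i)].

Lemma embed_restrict s x : in_levels s -> act (elt x) =1 id ->
  (forall v, v \notin s -> base (elt x) v = 1) -> embed (restrict s x) = x.
Proof.
move=> Xs x1 x_s; apply: val_inj; rewrite /= elt_embed //; apply: wreathP => v //=.
have [vs|vs] := boolP (v \in s); last by rewrite extend_out ?x_s.
by rewrite -[v]/(ssval (SeqSub vs)) extend_in ffunE.
Qed.

(** Conjugation preserves the sizes of the vertices in the support, so all
    conjugates are labellings of one finite set of vertices. *)
Lemma embed_finite_class s h : in_levels s -> finite_class (embed (s:=s) h).
Proof.
move=> Xs; pose N := (\max_(u <- s) size u).+1.
(* All vertices on levels of X up to the maximal level met by s. *)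
pose L := [seq v <- flatten [seq vertices i | i <- iota 0 N] | X (size v)].
have XL : in_levels L by apply: filter_all.
apply: (@sub_finite_set _ _ (range (@embed L))); last first.
  by apply: finite_image; apply: finite_finset.
move=> _ [y _ <-]; exists (restrict L (embed h ^ y)) => //.
apply: embed_restrict => // [v|v].
  by rewrite -[elt _]/(elt (embed h) ^ elt y) elt_embed //= actK.
move=> vL; rewrite -[elt _]/(elt (embed h) ^ elt y) elt_embed //=.
have [w Ew] := Gamma_eval_act y.
rewrite extend_out ?mul1g ?actK ?mulVg // Ew.
apply: contra vL => ws; rewrite mem_filter.
rewrite -(size_eval w) (allP Xs _ ws) andTb; apply/flattenP.
exists (vertices (size v)); last by rewrite mem_vertices.
apply: map_f; rewrite mem_iota /= add0n ltnS -(size_eval w).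
exact: leq_bigmax_seq.
Qed.
End GammaTheory.

(** * Classes carried by full levels, and their invariance *)
Lemma card_pred_II (F : finType) (P : {pred F}) : [set` P] #= `I_#|P|.
Proof.
have -> : [set` P] = (@enum_val F P) @` [set: 'I_#|P|].
  apply/seteqP; split=> [x Px|_ [i _ <-]]; last exact: enum_valP.
  by exists (enum_rank_in Px x) => //; rewrite enum_rankK_in.
apply: card_eq_trans (card_esym card_II).
by apply: inj_card_eq => i j _ _; apply: enum_val_inj.
Qed.

Lemma base_conjg (T : finGroupType) (x y : wreath T) u : act x =1 id ->
  base (x ^ y) u = base x (act y u) ^ base y u.
Proof. by move=> x1; rewrite conjgE !baseM actM x1 baseV actK. Qed.

Section Homogeneous.
Variables (T : finGroupType) (X : nat -> bool).
Hypothesis perfectT : perfect T.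
Hypothesis centerlessT : centerless T.
Hypothesis order3_conj : order3_transitive T.
Variable t3 : T.
Hypothesis t3P : order3 t3.
Hypothesis unboundedX : unbounded X.
Local Notation Gamma := (Gamma T X).

Let t3_neq1 : t3 != 1. Proof. by case/andP: t3P. Qed.

(** The labellings of support exactly [s] by elements of order 3. *)
Definition full_class (s : seq vertex) : set Gamma :=
  @embed T X s @` [set h : {dffun seq_sub s -> T} | forall i, order3 (h i)].

Lemma embed_inj s : in_levels X s -> injective (@embed T X s).
Proof.
move=> Xs h h' E; apply/ffunP => i.
have := congr1 (fun x => base (elt x) (ssval i)) E.
by rewrite !(elt_embed perfectT) //= !extend_in.
Qed.

Lemma card_full_class s : in_levels X s -> uniq s ->
  full_class s #= `I_(#|@order3 T| ^ size s)%N.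
Proof.
move=> Xs us.
apply: (@card_eq_trans _ _ _ _ [set h : {dffun seq_sub s -> T} | forall i, order3 (h i)]).
  by apply: inj_card_eq => h h' _ _; apply: embed_inj.
have -> : [set h : {dffun seq_sub s -> T} | forall i, order3 (h i)] =
   [set` (ffun_on (@order3 T) : {pred {ffun seq_sub s -> T}})].
  by apply/seteqP; split=> h /ffun_onP.
by rewrite -(card_seq_sub us) -card_ffun_on; apply: card_pred_II.
Qed.

Lemma full_class_conj s (x y : Gamma) : in_levels X s -> act (elt x) =1 id ->
  (forall v, v \notin s -> base (elt x) v = 1) ->
  (forall v, v \in s -> order3 (base (elt x) v)) ->
  full_class s y -> exists2 z, finite_class z & x ^ z = y.
Proof.
move=> Xs x1 xs x3 [h h3 <-].
have /choice[g gE] : forall i : seq_sub s, exists z, base (elt x) (ssval i) ^ z = h i.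
  by move=> i; apply: order3_conj; [apply: x3; apply: ssvalP|apply: h3].
exists (embed X ([ffun i => g i] : {dffun seq_sub s -> T})).
  exact: embed_finite_class.
apply: val_inj; apply: wreathP => v.
  rewrite -[val (x ^ _)]/(elt x ^ elt _) base_conjg // -[val _]/(elt _).
  rewrite !(elt_embed perfectT) //=.
  have [vs|vs] := boolP (v \in s); last by rewrite !extend_out // xs // conj1g.
  by rewrite -[v]/(ssval (SeqSub vs)) !extend_in ffunE gE.
rewrite -[val (x ^ _)]/(elt x ^ elt _) -[val _]/(elt _) conjgE !actM actV.
by rewrite !(elt_embed perfectT) //= x1.
Qed.

Lemma finite_class_support_seq (x : Gamma) : finite_class x ->
  exists2 s, uniq s & forall v, (v \in s) = (base (elt x) v != 1).
Proof.
move=> x_fc; have /finite_seqP[s sE] := finite_class_support perfectT centerlessT t3_neq1 x_fc.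
exists (undup s) => [|v]; first exact: undup_uniq.
rewrite mem_undup; apply/idP/idP => v_s; first by have : support x v by rewrite sE.
by have : support x v by []; rewrite sE.
Qed.

(** A conjugator with a finite class is a labelling, hence keeps the support.  So
    the support of [x] is invariant under G, that is, a union of levels; and the
    labels can be conjugated independently at each vertex. *)
Lemma homogeneous3_full s (x : Gamma) : homogeneous3 x ->
  (forall v, (v \in s) = (base (elt x) v != 1)) ->
  [/\ in_levels X s, forall u v, v \in s -> size u = size v -> u \in s
    & conj_class x = full_class s].
Proof.
case=> x3 x_fc x_inv mem_s.
have x1 := finite_class_act perfectT centerlessT unboundedX t3_neq1 x_fc.
have Xs : in_levels X s.
  by apply/allP => v; rewrite mem_s; apply: contraNT => /base_outside ->.
have out v : v \notin s -> base (elt x) v = 1 by rewrite mem_s negbK => /eqP.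
have base3 v : v \in s -> order3 (base (elt x) v).
  move=> vs; rewrite /order3 /= -mem_s vs /=; apply/eqP.
  have := congr1 (fun z => base (elt z) v) x3.
  by rewrite !expgS expg0 /= !x1 !mulgA !mulg1.
split=> //.
  move=> u v vs uv; have [w Ew] := eval_transitive uv.
  have [y [yG ay _]] := eval_Gamma T X w.
  have [z z_fc E] := x_inv (MkGamma (mem_set yG)).
  have := congr1 (fun z => base (elt z) u) E.
  rewrite -[elt (x ^ z)]/(elt x ^ elt z) -[elt (x ^ _)]/(elt x ^ y) !base_conjg //.
  rewrite (finite_class_act perfectT centerlessT unboundedX t3_neq1 z_fc) ay Ew mem_s => Eu.
  by apply: contraTneq vs => xu; rewrite mem_s negbK -(conjg_eq1 _ (base y u)) Eu xu conj1g.
apply/seteqP; split; last first.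
  by move=> y /(full_class_conj Xs x1 out base3)[z _ <-]; exists z.
move=> _ [y _ <-]; have [z z_fc ->] := x_inv y.
have z1 := finite_class_act perfectT centerlessT unboundedX t3_neq1 z_fc.
have bE v : base (elt (x ^ z)) v = base (elt x) v ^ base (elt z) v.
  by rewrite -[elt (x ^ z)]/(elt x ^ elt z) base_conjg // z1.
exists (restrict s (x ^ z)).
  move=> i; rewrite ffunE bE; have /andP[N1 /eqP E3] := base3 _ (ssvalP i).
  by rewrite /order3 /= conjg_eq1 N1 -conjXg E3 conj1g eqxx.
apply: (embed_restrict perfectT) => // [v|v vs]; last by rewrite bE out ?conj1g.
by rewrite -[elt (x ^ z)]/(elt x ^ elt z) conjgE !actM x1 actV actK.
Qed.

Definition level_class n := full_class (vertices n).

Lemma in_levels_vertices n : X n -> in_levels X (vertices n).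
Proof. by move=> Xn; apply/allP => v; rewrite mem_vertices => /eqP ->. Qed.

Lemma level_class_elt n (x : Gamma) : X n -> level_class n x ->
  [/\ act (elt x) =1 id, forall v, v \notin vertices n -> base (elt x) v = 1
    & forall v, v \in vertices n -> order3 (base (elt x) v)].
Proof.
move=> Xn [h h3 <-] {x}; rewrite (elt_embed perfectT) ?in_levels_vertices //.
split=> [//|v vn|v vn]; first exact: extend_out.
by rewrite -[base _ v]/(extend h (ssval (SeqSub vn))) extend_in; apply: h3.
Qed.

Lemma level_classJ n (x y : Gamma) : X n -> level_class n x -> level_class n (x ^ y).
Proof.
move=> Xn xn; have [x1 out base3] := level_class_elt Xn xn.
have [w Ew] := Gamma_eval_act y.
have mem_w v : (act (elt y) v \in vertices n) = (v \in vertices n).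
  by rewrite Ew !mem_vertices size_eval.
have bE v : base (elt (x ^ y)) v = base (elt x) (act (elt y) v) ^ base (elt y) v.
  by rewrite -[elt (x ^ y)]/(elt x ^ elt y) base_conjg.
exists (restrict (vertices n) (x ^ y)).
  move=> i; rewrite ffunE bE.
  have /andP[N1 /eqP E3] : order3 (base (elt x) (act (elt y) (ssval i))).
    by apply: base3; rewrite mem_w; apply: ssvalP.
  by rewrite /order3 /= conjg_eq1 N1 -conjXg E3 conj1g eqxx.
apply: (embed_restrict perfectT) => [|v|v vn]; first exact: in_levels_vertices.
  by rewrite -[elt (x ^ y)]/(elt x ^ elt y) conjgE !actM x1 actV actK.
by rewrite bE out ?conj1g // mem_w.
Qed.

Lemma level_class_homogeneous3 n (x : Gamma) : X n -> level_class n x -> homogeneous3 x.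
Proof.
move=> Xn xn; have [x1 out base3] := level_class_elt Xn xn.
split.
- apply: val_inj; apply: wreathP => v /=; last by rewrite !x1.
  rewrite !expgS expg0 /= !x1 mulg1.
  have [/base3/andP[_ /eqP E3]|/out ->] := boolP (v \in vertices n).
    by rewrite -E3 !expgS expg0 mulg1.
  by rewrite !mulg1.
- by case: xn => h _ <-; apply: embed_finite_class => //; apply: in_levels_vertices.
- move=> y; have := level_classJ y Xn xn.
  by case/(full_class_conj (in_levels_vertices Xn) x1 out base3)=> z z_fc <-; exists z.
Qed.

Definition level_elt n : Gamma := embed X ([ffun=> t3] : {dffun seq_sub (vertices n) -> T}).

Lemma level_elt_in n : level_class n (level_elt n).
Proof. by exists [ffun=> t3] => // i; rewrite ffunE. Qed.

End Homogeneous.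

Section Rigidity.
Variable T : finGroupType.
Hypothesis perfectT : perfect T.
Hypothesis centerlessT : centerless T.
Hypothesis order3_conj : order3_transitive T.
Variable t3 : T.
Hypothesis t3P : order3 t3.
Hypothesis gt1_order3 : 1 < #|@order3 T|.

Lemma sum_pow3_lt n : (\sum_(i < n) 3 ^ i < 3 ^ n)%N.
Proof.
elim: n => [|n IH]; first by rewrite big_ord0.
rewrite big_ord_recr /= expnS; move: IH; set S := bigop _ _ _; lia.
Qed.

(** If level n is missing, then all levels in [s] are below n, and
    1 + 3 + ... + 3^(n-1) < 3^n. *)
Lemma levels_of_size3 s n : uniq s -> size s = (3 ^ n)%N ->
  (forall u v, v \in s -> size u = size v -> u \in s) -> s =i vertices n.
Proof.
move=> us size_s s_inv.
have lev v : v \in s -> {subset vertices (size v) <= s}.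
  by move=> vs u; rewrite mem_vertices => /eqP; apply: s_inv.
have [nin|] := boolP (has (fun v => size v == n) s); last first.
  move=> /hasPn s_n.
  have s_lt v : v \in s -> size v < n.
    move=> vs; have := uniq_leq_size (uniq_vertices _) (lev v vs).
    by rewrite size_s size_vertices leq_exp2l // leq_eqVlt (negPf (s_n v vs)).
  have : {subset s <= flatten [seq vertices i | i <- iota 0 n]}.
    move=> v vs; apply/flattenP; exists (vertices (size v)).
      by apply: map_f; rewrite mem_iota s_lt.
    by rewrite mem_vertices.
  move=> /(uniq_leq_size us); rewrite size_s size_flatten /shape -map_comp sumnE big_map.
  rewrite -(subn0 n) -/(index_iota 0 n) big_mkord leqNgt subn0.
  by rewrite (eq_bigr (fun i : 'I_n => 3 ^ i)%N) ?sum_pow3_lt // => i _; apply: size_vertices.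
have [v vs /eqP vn] := hasP nin.
have sub : {subset vertices n <= s} by rewrite -vn; apply: lev.
have [|_ E u] := uniq_min_size (uniq_vertices n) sub; last by rewrite E.
by rewrite size_s size_vertices.
Qed.

(** The class of level n has k^(3^n) elements, k > 1 being the number of elements
    of order 3 in [T]; so the image of one of its elements is supported on 3^n
    vertices forming a union of levels. *)
Lemma iso_level (X Y : nat -> bool) (f : {multiplicative Gamma T X -> Gamma T Y}) n :
  unbounded X -> unbounded Y ->
  bijective f -> X n ->
  Y n /\ f @` @level_class T X n = @level_class T Y n.
Proof.
move=> Xinf Yinf bij_f Xn; set x := @level_elt T X t3 n.
have x_n : level_class n x by apply: level_elt_in.
have x_hom : homogeneous3 x := level_class_homogeneous3 perfectT order3_conj Xn x_n.
have x_mem v : (v \in vertices n) = (base (elt x) v != 1).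
  rewrite (elt_embed perfectT) ?in_levels_vertices //=.
  have [vn|vn] := boolP (v \in vertices n); last by rewrite extend_out // eqxx.
  rewrite -[extend _ v]/(extend _ (ssval (SeqSub vn))) extend_in ffunE.
  by case/andP: t3P => ->.
have [_ _ class_x] := homogeneous3_full perfectT centerlessT order3_conj t3P Xinf x_hom x_mem.
have fx_hom := homogeneous3_iso bij_f x_hom.
have [_ fx_fc _] := fx_hom.
have [s us s_mem] := finite_class_support_seq perfectT centerlessT t3P fx_fc.
have [Ys s_inv class_fx] :=
  homogeneous3_full perfectT centerlessT order3_conj t3P Yinf fx_hom s_mem.
rewrite (conj_class_iso bij_f) class_x in class_fx.
have : `I_(#|@order3 T| ^ 3 ^ n)%N #= `I_(#|@order3 T| ^ size s)%N.
  apply: card_eq_trans (card_full_class perfectT Ys us).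
  rewrite -class_fx; apply: card_esym; rewrite -size_vertices.
  apply: card_eq_trans (card_full_class perfectT (in_levels_vertices Xn) (uniq_vertices n)).
  by apply: inj_card_eq => y z _ _; apply: bij_inj.
move=> /card_eq_II /eqP; rewrite eqn_exp2l // => /eqP/esym size_s.
have sE := levels_of_size3 us size_s s_inv.
have Yn : Y n.
  have : spine n \in s by rewrite sE mem_vertices size_nseq.
  by move=> /(allP Ys); rewrite size_nseq.
split=> //; rewrite -[level_class n]class_x -(conj_class_iso bij_f).
have fx_mem v : (v \in vertices n) = (base (elt (f x)) v != 1) by rewrite -sE s_mem.
by have [] := homogeneous3_full perfectT centerlessT order3_conj t3P Yinf fx_hom fx_mem.
Qed.
End Rigidity.

(** * Twisted conjugacy *)
(** Count the pairs (c, a) with sigma c = c ^ a.  For a given c the solutions a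
    form a coset of the centraliser of c or the empty set, and C lies in one
    conjugacy class, so there are at most |N| pairs.  If every a had a solution c,
    then c^-1 would be a second one, and there would be at least 2 |N| pairs. *)
Lemma twisted_avoid (N : finGroupType) (C : {set N}) (sigma : N -> N) :
  {in C &, forall c d, exists a, c ^ a = d} ->
  {in C, forall c, [/\ c^-1 \in C, c^-1 != c & sigma c^-1 = (sigma c)^-1]} ->
  exists a, forall c, c \in C -> sigma c != c ^ a.
Proof.
move=> C_trans C_inv; apply: contrapT => /forallNP all_hit.
pose A c := [set a | sigma c == (c ^ a)%g]%SET.
have cardA c : c \in C -> (#|A c| * #|C| <= #|N|)%N.
  move=> cC; have le_cent : (#|A c| <= #|'C[c]|)%N.
    have [->|[a0]] := set_0Vmem (A c); first by rewrite cards0.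
    rewrite finset.in_set => /eqP a0c; rewrite -(card_rcoset 'C[c] a0); apply: subset_leq_card.
    apply/fintype.subsetP => a; rewrite finset.in_set => /eqP ac.
    rewrite mem_rcoset cent1C; apply/cent1P.
    by apply/commgP/conjg_fixP; rewrite conjgM -ac a0c conjgK.
  have le_class : (#|C| <= #|c ^: [set: N]%SET|)%N.
    apply: subset_leq_card; apply/fintype.subsetP => d /(C_trans c d cC)[a <-].
    by apply: imset_f; rewrite finset.in_setT.
  apply: (leq_trans (leq_mul le_cent le_class)).
  by rewrite -index_cent1 finset.setTI Lagrange ?finset.subsetT ?cardsT.
have sumA : (\sum_(c in C) #|A c|
    = \sum_(a : N) #|[set c in C | sigma c == (c ^ a)%g]%SET|)%N.
  transitivity (\sum_(c in C) \sum_(a : N) (sigma c == (c ^ a)%g))%N.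
    by apply: eq_bigr => c _; rewrite -sum1dep_card big_mkcond.
  rewrite exchange_big; apply: eq_bigr => a _.
  by rewrite -sum1dep_card big_mkcondr.
have ge2 a : (2 <= #|[set c in C | sigma c == (c ^ a)%g]%SET|)%N.
  have /existsNP[c /not_implyP[cC /negP]] := all_hit a; rewrite negbK => /eqP sc.
  have [cVC cV sV] := C_inv c cC.
  have <- : #|[set c; c^-1]%SET| = 2 by rewrite cards2 eq_sym cV.
  apply: subset_leq_card; apply/fintype.subsetP => d; rewrite !finset.inE => /orP[]/eqP->.
    by rewrite cC sc eqxx.
  by rewrite cVC sV sc conjVg eqxx.
have C_gt0 : (0 < #|C|)%N.
  have /existsNP[c /not_implyP[cC _]] := all_hit 1; by apply/card_gt0P; exists c.
have N_gt0 : (0 < #|N|)%N by apply/card_gt0P; exists 1.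
have lower : (#|N| * 2 <= \sum_(c in C) #|A c|)%N.
  by rewrite sumA -sum_nat_const; apply: leq_sum => a _.
have : ((\sum_(c in C) #|A c|) * #|C| <= #|N| * #|C|)%N.
  by rewrite big_distrl /= mulnC -sum_nat_const; apply: leq_sum => c; apply: cardA.
rewrite leq_pmul2r //; lia.
Qed.

Definition hits (G : groupType) (phi : G -> G) (K : set G) (a : G) : Prop :=
  exists2 c, K c & phi c = c ^ a^-1.

(** If c is a solution for a, then x^-1 c x is one for phi(x^-1) a x. *)
Lemma hits_twisted (G : groupType) (phi : {multiplicative G -> G}) (K : set G) a b :
  (forall x y, K x -> K (x ^ y)) -> twisted_conjugate phi a b ->
  hits phi K a -> hits phi K b.
Proof.
move=> KJ [x <-] [c Kc phi_c]; exists (c ^ x); first exact: KJ.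
rewrite multiplicativeJ phi_c -!conjgM !invgM multiplicativeV invgK; congr conjg.
by rewrite mulVKg.
Qed.

Section Reidemeister.
Variables (T : finGroupType) (X : nat -> bool).
Hypothesis perfectT : perfect T.
Hypothesis centerlessT : centerless T.
Hypothesis order3_conj : order3_transitive T.
Variable t3 : T.
Hypothesis t3P : order3 t3.
Hypothesis gt1_order3 : (1 < #|@order3 T|)%N.
Hypothesis unboundedX : unbounded X.
Local Notation Gamma := (Gamma T X).

Variable phi : {multiplicative Gamma -> Gamma}.
Hypothesis bij_phi : bijective phi.

Lemma embedM s (h k : {dffun seq_sub s -> T}) : in_levels X s ->
  embed X (h * k) = embed X h * embed X k.
Proof.
move=> Xs; apply: val_inj; rewrite /= !(elt_embed perfectT) //.
apply: wreathP => v //=; rewrite /extend; case: insub => [i|]; last by rewrite mulg1.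
by rewrite mulg_ffun.
Qed.

Lemma embed1 s : in_levels X s -> embed X (1 : {dffun seq_sub s -> T}) = 1.
Proof.
move=> Xs; apply: (mulgI (embed X (1 : {dffun seq_sub s -> T}))).
by rewrite -embedM // !mulg1.
Qed.

Lemma embedV s (h : {dffun seq_sub s -> T}) : in_levels X s ->
  embed X h^-1 = (embed X h)^-1.
Proof. by move=> Xs; apply: (mulgI (embed X h)); rewrite -embedM // !mulgV embed1. Qed.

Lemma embedJ s (h k : {dffun seq_sub s -> T}) : in_levels X s ->
  embed X (h ^ k) = embed X h ^ embed X k.
Proof. by move=> Xs; rewrite !conjgE !embedM ?embedV. Qed.

Lemma embed_disjoint s s' (h : {dffun seq_sub s -> T}) (k : {dffun seq_sub s' -> T}) :
  in_levels X s -> in_levels X s' -> (forall v, v \in s -> v \notin s') ->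
  embed X h ^ embed X k = embed X h.
Proof.
move=> Xs Xs' disj; apply: val_inj.
rewrite -[val (_ ^ _)]/(elt (embed X h) ^ elt (embed X k)) -[val _]/(elt (embed X h)).
rewrite !(elt_embed perfectT) //; apply: wreathP => v //; rewrite base_conjg //=.
have [/disj vs'|vs] := boolP (v \in s); last by rewrite extend_out ?conj1g.
by rewrite (extend_out k) // conjg1.
Qed.

Lemma level_hits_vary n : X n -> exists a b : {dffun seq_sub (vertices n) -> T},
  hits phi (@level_class T X n) (embed X a) /\ ~ hits phi (@level_class T X n) (embed X b).
Proof.
move=> Xn; have XL := in_levels_vertices Xn.
have [_ phi_level] := iso_level perfectT centerlessT order3_conj t3P gt1_order3
  unboundedX unboundedX bij_phi Xn.
pose N := {dffun seq_sub (vertices n) -> T}.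
pose C := [set h : N | [forall i, order3 (h i)]]%SET.
have inC h : h \in C -> forall i, order3 (h i) by rewrite finset.in_set => /forallP.
have CP (h : N) : (forall i, order3 (h i)) -> h \in C.
  by move=> h3; rewrite finset.in_set; apply/forallP.
pose sigma (h : N) : N := restrict (vertices n) (phi (embed X h)).
have sigmaP h : h \in C -> sigma h \in C /\ embed X (sigma h) = phi (embed X h).
  move=> hC; have : level_class n (phi (embed X h)).
    by rewrite -phi_level; exists (embed X h) => //; exists h => //; apply: inC.
  case=> k k3 kE; suff Ek : sigma h = k by rewrite Ek; split=> //; apply: CP.
  apply/ffunP => i; rewrite ffunE -kE (elt_embed perfectT) //=.
  by rewrite extend_in.
have ffunJ (c a : N) i : (c ^ a) i = c i ^ a i.
  by rewrite !conjgE !mulg_ffun invg_ffun.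
have C_trans : {in C &, forall c d, exists a, c ^ a = d}.
  move=> c d /inC c3 /inC d3; have /choice[g gE] i := order3_conj (c3 i) (d3 i).
  by exists ([ffun i => g i] : N); apply/ffunP => i; rewrite ffunJ ffunE gE.
have C_inv : {in C, forall c, [/\ c^-1 \in C, c^-1 != c & sigma c^-1 = (sigma c)^-1]}.
  move=> c cC; have c3 := inC c cC; have cVC : c^-1 \in C.
    apply: CP => i; rewrite invg_ffun /order3 /= invg_eq1 expVgn invg_eq1.
    exact: c3.
  split=> //.
    have i : seq_sub (vertices n).
      by apply: (@SeqSub _ _ (spine n)); rewrite mem_vertices size_nseq.
    apply/negP => /eqP/ffunP/(_ i); rewrite invg_ffun => E.
    have /andP[/negP N1 /eqP E3] := c3 i; apply: N1; apply/eqP.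
    have cc : c i * c i = 1 by rewrite -{1}E mulVg.
    by rewrite -E3 !expgS expg0 mulg1 cc mulg1.
  apply: (embed_inj perfectT XL).
  have [_ ->] := sigmaP _ cVC; rewrite !embedV //.
  by have [_ ->] := sigmaP _ cC; rewrite multiplicativeV.
have [b b_avoid] := twisted_avoid C_trans C_inv.
have t3C : ([ffun=> t3] : N) \in C by apply: CP => i; rewrite ffunE.
have [stC stE] := sigmaP _ t3C.
have [a aE] := C_trans _ _ t3C stC.
(* The inverses come from hits using c ^ a^-1 = a c a^-1. *)
exists a^-1, b^-1; split.
  exists (embed X ([ffun=> t3] : N)); first by exists [ffun=> t3] => //; apply: inC.
  by rewrite embedV // invgK -embedJ // aE stE.
case=> _ [h h3 <-]; rewrite embedV // invgK -embedJ // => E.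
have hC := CP h h3; have [_ Eh] := sigmaP _ hC.
by have /eqP := b_avoid _ hC; apply; apply: (embed_inj perfectT XL); rewrite Eh.
Qed.

(** [d n] lies over level [n] and, for the class of level [n], the answer to
    [hits] at [d n] differs from the answer at 1, while all other [d m] commute with
    that class and give the answer of 1. *)
Lemma twisted_classes_infinite : infinite_set (twisted_classes phi).
Proof.
have /choice[d dP] n : exists x : Gamma, X n ->
   (exists a : {dffun seq_sub (vertices n) -> T}, x = embed X a) /\
   (hits phi (@level_class T X n) x <-> ~ hits phi (@level_class T X n) 1).
  have [Xn|Xn] := boolP (X n); last by exists 1.
  have [a [b [hit_a avoid_b]]] := level_hits_vary Xn.
  have [hit1|avoid1] := pselect (hits phi (@level_class T X n) 1).
    by exists (embed X b) => _; split; [exists b|split].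
  by exists (embed X a) => _; split; [exists a|split].
have d_other n m : X n -> X m -> n <> m ->
    (hits phi (@level_class T X n) (d m) <-> hits phi (@level_class T X n) 1).
  move=> Xn Xm nm; have [[a ->] _] := dP m Xm.
  have commute_a c : level_class n c -> c ^ (embed X a)^-1 = c.
    case=> h _ <-; rewrite -embedV ?in_levels_vertices //.
    apply: embed_disjoint; rewrite ?in_levels_vertices // => v.
    by rewrite !mem_vertices => /eqP ->; apply/eqP.
  split=> -[c cn E]; exists c => //; rewrite E commute_a // invg1 conjg1 //.
have levelJ n (x y : Gamma) : X n -> level_class n x -> level_class n (x ^ y).
  by move=> Xn; apply: (level_classJ perfectT).
have d_inj n m : X n -> X m -> twisted_class phi (d n) = twisted_class phi (d m) -> n = m.
  move=> Xn Xm E; apply: contrapT => nm.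
  have refl x : twisted_conjugate phi x x.
    by exists 1; rewrite invg1 multiplicative1 mul1g mulg1.
  have nm_conj : twisted_conjugate phi (d n) (d m).
    by rewrite -[twisted_conjugate _ _ _]/(twisted_class phi (d n) (d m)) E; apply: refl.
  have mn_conj : twisted_conjugate phi (d m) (d n).
    by rewrite -[twisted_conjugate _ _ _]/(twisted_class phi (d m) (d n)) -E; apply: refl.
  have [_ dn] := dP n Xn; have dm := d_other n m Xn Xm nm.
  have KJ x y := @levelJ n x y Xn.
  have to_m := hits_twisted KJ nm_conj; have to_n := hits_twisted KJ mn_conj.
  tauto.
move=> fin; have : finite_set [set n | X n].
  have : finite_set ((fun n => twisted_class phi (d n)) @` [set n | X n]).
    by apply: sub_finite_set fin => _ [n _ <-]; exists (d n).
  have E : (fun n => twisted_class phi (d n)) @` [set n | X n] #= [set n | X n].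
    by apply: inj_card_eq => n m; rewrite !inE; apply: d_inj.
  by rewrite (eq_finite_set E).
move=> /finite_seqP[s sE]; have [m lt_m Xm] := unboundedX (\max_(i <- s) i).+1.
have : [set n | X n] m by []; rewrite sE /= => ms.
have : (m <= \max_(i <- s) i)%N by exact: (@leq_bigmax_seq _ s xpredT id).
by rewrite leqNgt lt_m.
Qed.
End Reidemeister.

(** * The alternating group of degree 5 *)
Section Simple.
Variable T : finGroupType.
Hypothesis simpleT : simple [set: T]%G.
Hypothesis nonsolvableT : solvable [set: T]%G = false.

Lemma simple_perfect : perfect T.
Proof.
move=> H HR x; have [_ simpT] := simpleP _ simpleT.
have [D1|DT] := simpT _ (der_normal 1 [set: T]%G).
  move: nonsolvableT; rewrite abelian_sol //; apply/commG1P; exact: D1.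
have : ([set: T]%G^`(1) \subset H)%g.
  by rewrite gen_subG; apply/fintype.subsetP => _ /imset2P[y z _ _ ->].
by rewrite DT => /fintype.subsetP; apply; rewrite finset.in_setT.
Qed.

Lemma simple_centerless : centerless T.
Proof.
move=> b b1; apply: contrapT => /forallNP noncomm.
have [_ simpT] := simpleP _ simpleT.
have [Z1|ZT] := simpT _ (center_normal [set: T]%G).
  have : b \in 'Z([set: T]%G).
    apply/centerP; split=> [|t _]; first by rewrite finset.in_setT.
    by apply/commgP; have /negP := noncomm t; rewrite negbK.
  by rewrite Z1 => /set1P /eqP; apply/negP.
have cT : abelian [set: T]%G by apply/center_idP.
by move: nonsolvableT; rewrite abelian_sol.
Qed.

Variables x y : T.
Hypothesis x3 : order3 x.
Hypothesis xJ : x ^ y = x^-1.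
Hypothesis log3T : logn 3 #|T| = 1%N.

Lemma order3E (t : T) : order3 t = (#[t] == 3)%N.
Proof.
apply/andP/eqP => [[t1 /eqP E3]|t3]; first exact: nt_prime_order.
by have := expg_order t; rewrite -order_gt1 t3 => ->; rewrite eqxx.
Qed.

Lemma order3_sylow t : order3 t -> 3.-Sylow([set: T]%G) <[t]>.
Proof.
rewrite order3E => /eqP t3; rewrite pHallE finset.subsetT /= -orderE t3 cardsT.
by rewrite p_part log3T.
Qed.

(** By Sylow's theorem the subgroups generated by [t] and [x] are conjugate, which
    takes [t] to [x] or to its inverse; and [y] exchanges these two. *)
Lemma order3_conj_base t : order3 t -> exists z, t ^ z = x.
Proof.
move=> t3; have [z _ E] := Sylow_trans (order3_sylow x3) (order3_sylow t3).
have : t \in <[x ^ z]> by rewrite cycleJ -E cycle_id.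
have t1 : t != 1 by case/andP: t3.
move=> /cyclePmin[m]; have -> : #[x ^ z] = 3.
  by rewrite orderJ; apply/eqP; rewrite -order3E.
case: m => [|[|[|//]]] _ tE; first by rewrite tE eqxx in t1.
  by exists z^-1; rewrite tE expg1 conjgK.
exists (z^-1 * y); rewrite tE conjgM conjXg conjgK conjXg xJ.
have xV : x^-1 = x * x.
  apply: mulg1_eq; case/andP: x3 => _ /eqP; rewrite !expgS expg0 mulg1; exact.
by rewrite !expgS expg0 mulg1 {2}xV mulKg.
Qed.

Lemma order3_conj_all : order3_transitive T.
Proof.
move=> t u /order3_conj_base[z1 t_x] /order3_conj_base[z2 u_x].
by exists (z1 * z2^-1); rewrite conjgM t_x -u_x conjgK.
Qed.

Lemma card_order3_gt1 : (1 < #|@order3 T|)%N.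
Proof.
have xV3 : order3 x^-1.
  by case/andP: x3 => x1 /eqP E3; rewrite /order3 /= invg_eq1 x1 expVgn E3 invg1 eqxx.
apply/card_gt1P; exists x, x^-1; split=> //.
apply/negP => /eqP xV; case/andP: x3 => /negP x1 /eqP E3; apply: x1; apply/eqP.
have xx : x * x = 1 by rewrite {1}xV mulVg.
by rewrite -E3 !expgS expg0 mulg1 xx mulg1.
Qed.
End Simple.

Definition A5 := subg_of 'Alt_('I_5).

Lemma A5_isog : 'Alt_('I_5) \isog [set: A5]%G.
Proof. exact: isog_subg. Qed.

Lemma simple_A5 : simple [set: A5]%G.
Proof. by rewrite -(isog_simple A5_isog) simple_Alt5 // card_ord. Qed.

Lemma nonsolvable_A5 : solvable [set: A5]%G = false.
Proof. by rewrite -(isog_sol A5_isog) solvable_AltF // card_ord. Qed.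

Lemma logn3_card_A5 : logn 3 #|A5| = 1%N.
Proof.
rewrite -cardsT -(card_isog A5_isog).
have := @card_Alt 'I_5; rewrite card_ord => /(_ isT) E.
by have -> : #|'Alt_('I_5)| = 60 by move: E; rewrite !factS fact0; lia.
Qed.

(** The 3-cycle (0 2 1) is inverted by (0 1)(3 4), which is even. *)
Lemma A5_3cycle : exists x y : A5, order3 x /\ x ^ y = x^-1.
Proof.
pose i (k : nat) (lt_k : (k < 5)%N) : 'I_5 := Ordinal lt_k.
pose p : 'S_5 := tperm (@i 0%N isT) (@i 1%N isT) * tperm (@i 1%N isT) (@i 2%N isT).
pose q : 'S_5 := tperm (@i 0%N isT) (@i 1%N isT) * tperm (@i 3%N isT) (@i 4%N isT).
have pA : p \in 'Alt_('I_5) by rewrite Alt_even odd_permM !odd_tperm.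
have qA : q \in 'Alt_('I_5) by rewrite Alt_even odd_permM !odd_tperm.
(* Both identities hold on each of the five points. *)
have p3 : p * p * p = 1.
  by apply/permP => -[[|[|[|[|[|k]]]]] lt_k] //; rewrite /p !permM !permE; apply: val_inj.
have pq : p * q * p = q.
  by apply/permP => -[[|[|[|[|[|k]]]]] lt_k] //; rewrite /p /q !permM !permE; apply: val_inj.
have p1 : p != 1.
  by apply/eqP => /permP/(_ (@i 0%N isT)); rewrite /p !permM !permE => /(congr1 val).
exists (subg 'Alt_('I_5) p), (subg 'Alt_('I_5) q); split.
  apply/andP; split.
    apply: contra p1 => /eqP/(congr1 sgval); rewrite subgK // => ->; exact: eqxx.
  by apply/eqP; apply: val_inj; rewrite !expgS expg0 mulg1 /= subgK // mulgA.
apply: (mulIg (subg _ p)); rewrite mulVg conjgE; apply: (mulgI (subg _ q)).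
rewrite mulg1 mulgA mulVKg; apply: val_inj; rewrite /= !subgK //.
Qed.

(** * The family of groups *)
Lemma eltX T X (x : Gamma T X) n : elt (x ^+ n) = elt x ^+ n.
Proof. by elim: n => // n IH; rewrite !expgS -IH. Qed.

Lemma Gamma_finitely_generated T X : finitely_generated (Gamma T X).
Proof.
exists (@elt T X @^-1` gens X); split.
  apply: finite_preimage => [x y _ _|]; first exact: val_inj.
  rewrite finite_setU; split; first exact: finite_set2.
  by apply: finite_image; apply: finite_finset.
apply/seteqP; split=> // x _ H [H_group H_gens].
have H_intro z : gens X (elt z) -> H z by apply: H_gens.
suff lift w : Gamma_set X w -> exists2 z : Gamma T X, elt z = w & H z.
  by have := eltP x; rewrite inE => /lift[z /val_inj <-].
move: w; apply: Gamma_ind.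
- by exists 1 => //; have := H_group.1; rewrite inE.
- move=> _ _ [y1 <- Hy1] [y2 <- Hy2]; exists (y1 * y2) => //.
  by have := group_closedM H_group (x := y1) (y := y2); rewrite !inE; apply.
- move=> _ [y <- Hy]; exists y^-1 => //.
  by have := group_closedV H_group (x := y); rewrite !inE; apply.
- have g : gens X (@rooted_elt T) by left; left.
  by exists (MkGamma (mem_set (Gamma_gens g))) => //; apply: H_intro.
- have g : gens X (@directed_elt T) by left; right.
  by exists (MkGamma (mem_set (Gamma_gens g))) => //; apply: H_intro.
- move=> t; have g : gens X (pure (spine_fun X t)) by right; exists t.
  by exists (MkGamma (mem_set (Gamma_gens g))) => //; apply: H_intro.
Qed.

Lemma Gamma_is_torsion T X : torsion (Gamma T X).
Proof.
move=> x; have := eltP x; rewrite inE => /Gamma_torsion[n [n0 xn]].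
by exists n; split=> //; apply: val_inj; rewrite /= eltX xn.
Qed.

(** One level from each pair 2k, 2k+1, chosen by the k-th bit: an infinite set
    whatever the sequence, and one which determines the sequence. *)
Definition levels (s : nat -> bool) (n : nat) : bool := odd n == s n./2.

Lemma levels_double s k : levels s (s k + k.*2)%N.
Proof. by rewrite /levels half_bit_double oddD odd_double addbF oddb. Qed.

Lemma levels_inj s r : (forall n, levels s n -> levels r n) -> s = r.
Proof.
move=> sr; apply: funext => k; have := sr _ (levels_double s k).
by rewrite /levels half_bit_double oddD odd_double addbF oddb => /eqP.
Qed.

Lemma levels_unbounded s : unbounded (levels s).
Proof.
move=> n; exists (s n + n.*2)%N; last exact: levels_double.
by rewrite -addnn addnA leq_addl.
Qed.

Lemma uncountable_bool_seq : ~ countable [set: nat -> bool].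
Proof.
move=> /countable_injP[f f_inj].
have /choice[g gE] n : exists s : nat -> bool, forall r, f r = n -> s = r.
  have [[s sn]|no_s] := pselect (exists s, f s = n).
    by exists s => r rn; apply: f_inj; rewrite ?inE // sn.
  by exists xpredT => r rn; case: no_s; exists r.
(* The diagonal sequence of an enumeration. *)
pose d n := ~~ g n n.
have : d (f d) = ~~ d (f d) by rewrite {1}/d (gE _ d erefl).
by case: (d _).
Qed.

Theorem corollary3p12 :
  exists (I : Type) (G : I -> groupType),
    [/\ ~ countable [set: I]%classic,
        forall i j : I, i <> j -> ~ isomorphic (G i) (G j)
      & forall i : I,
          [/\ finitely_generated (G i), torsion (G i) & R_infinity (G i)]].
Proof.
have [x [y [x3 xJ]]] := A5_3cycle.
have perf := simple_perfect simple_A5 nonsolvable_A5.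
have center := simple_centerless simple_A5 nonsolvable_A5.
have conj3 := order3_conj_all x3 xJ logn3_card_A5.
have many3 := card_order3_gt1 x3.
exists (nat -> bool), (fun s => Gamma A5 (levels s) : groupType); split.
- exact: uncountable_bool_seq.
- move=> s r sr [f bij_f]; apply: sr; apply: levels_inj => n sn.
  by have [] := iso_level perf center conj3 x3 many3
    (levels_unbounded s) (levels_unbounded r) bij_f sn.
- move=> s; split; [exact: Gamma_finitely_generated|exact: Gamma_is_torsion|].
  move=> phi bij_phi; exact: (twisted_classes_infinite perf center conj3 x3 many3
    (levels_unbounded s) bij_phi).
Qed.
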